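(* For any formulae $A, C$ and any derivation $f : A \Rightarrow C$ in the skew monoidal categorical calculus, there exists a unique focused derivation $h$ of $A \mid\ \vdash_{\mathsf L} C$ (stoup $A$, empty context) such that $f \doteq \mathrm{sound}(\mathrm{emb}_{\mathsf L}\, h)$. Equivalently, letting $\mathrm{focderivs}(A, (), C)$ be the finite duplicate-free list of all focused derivations of $A \mid\ \vdash_{\mathsf L} C$, the list $[\mathrm{sound}(\mathrm{emb}_{\mathsf L}\, h) \mid h \in \mathrm{focderivs}(A,(),C)]$ contains, for every $f : A \Rightarrow C$, exactly one entry $\doteq$-equivalent to $f$.
   Context: Fix a set $\mathrm{Var}$ of atoms. Formulae: atoms $X \in \mathrm{Var}$, $\mathsf{I}$, and $A \otimes B$. A context is a finite list of formulae; a stoup $S$ is either empty ($-$) or a single formula; a stoup $T$ is irreducible if $T = -$ or $T$ is an atom. Categorical calculus: judgements $A \Rightarrow C$ derived by $\mathrm{id}_A : A \Rightarrow A$; $g \circ f : A \Rightarrow C$ from $f : A \Rightarrow B$, $g : B \Rightarrow C$; $f \otimes g : A \otimes B \Rightarrow C \otimes D$ from $f : A \Rightarrow C$, $g : B \Rightarrow D$; axioms $\lambda_A : \mathsf{I} \otimes A \Rightarrow A$, $\rho_A : A \Rightarrow A \otimes \mathsf{I}$, $\alpha_{A,B,C} : (A \otimes B) \otimes C \Rightarrow A \otimes (B \otimes C)$. The relation $\doteq$ is the least congruence (w.r.t. $\circ$ and $\otimes$) containing: $f \circ \mathrm{id} \doteq f \doteq \mathrm{id} \circ f$; $h \circ (g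 \circ f) \doteq (h \circ g) \circ f$; $\mathrm{id}_A \otimes \mathrm{id}_B \doteq \mathrm{id}_{A \otimes B}$; $(h \circ f) \otimes (k \circ g) \doteq (h \otimes k) \circ (f \otimes g)$; $\lambda_B \circ (\mathrm{id}_{\mathsf I} \otimes f) \doteq f \circ \lambda_A$; $(f \otimes \mathrm{id}_{\mathsf I}) \circ \rho_A \doteq \rho_B \circ f$; $(f \otimes (g \otimes h)) \circ \alpha \doteq \alpha \circ ((f \otimes g) \otimes h)$; $\lambda_{\mathsf I} \circ \rho_{\mathsf I} \doteq \mathrm{id}_{\mathsf I}$; $(\mathrm{id}_A \otimes \lambda_B) \circ \alpha_{A,\mathsf I,B} \circ (\rho_A \otimes \mathrm{id}_B) \doteq \mathrm{id}_{A \otimes B}$; $\lambda_{A \otimes B} \circ \alpha_{\mathsf I,A,B} \doteq \lambda_A \otimes \mathrm{id}_B$; $\alpha_{A,B,\mathsf I} \circ \rho_{A \otimes B} \doteq \mathrm{id}_A \otimes \rho_B$; $\alpha_{A,B,C \otimes D} \circ \alpha_{A \otimes B,C,D} \doteq (\mathrm{id}_A \otimes \alpha_{B,C,D}) \circ \alpha_{A,B \otimes C,D} \circ (\alpha_{A,B,C} \otimes \mathrm{id}_D)$. ($\doteq$-classes are morphisms of the free skew monoidal category on $\mathrm{Var}$.) Cut-free sequent calculus: sequents $S \mid \Gamma \vdash C$ derived by (ax) $A \mid\ \vdash A$; (pass) from $A \mid \Gamma \vdash C$ infer $- \mid A, \Gamma \vdash C$; ($\mathsf I$L) from $- \mid \Gamma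 \vdash C$ infer $\mathsf I \mid \Gamma \vdash C$; ($\mathsf I$R) $- \mid\ \vdash \mathsf I$; ($\otimes$L) from $A \mid B, \Gamma \vdash C$ infer $A \otimes B \mid \Gamma \vdash C$; ($\otimes$R) from $S \mid \Gamma \vdash A$ and $- \mid \Delta \vdash B$ infer $S \mid \Gamma, \Delta \vdash A \otimes B$. Focused calculus: sequents $S \mid \Gamma \vdash_{\mathsf L} C$ and $T \mid \Gamma \vdash_{\mathsf R} C$ ($T$ irreducible), derived by: (pass) from $A \mid \Gamma \vdash_{\mathsf L} C$ infer $- \mid A, \Gamma \vdash_{\mathsf L} C$; (switch) from $T \mid \Gamma \vdash_{\mathsf R} C$ infer $T \mid \Gamma \vdash_{\mathsf L} C$; (ax$_X$) $X \mid\ \vdash_{\mathsf R} X$ for atoms $X$; ($\mathsf I$L) from $- \mid \Gamma \vdash_{\mathsf L} C$ infer $\mathsf I \mid \Gamma \vdash_{\mathsf L} C$; ($\mathsf I$R$_{\mathsf R}$) $- \mid\ \vdash_{\mathsf R} \mathsf I$; ($\otimes$L) from $A \mid B, \Gamma \vdash_{\mathsf L} C$ infer $A \otimes B \mid \Gamma \vdash_{\mathsf L} C$; ($\otimes$R$_{\mathsf R}$) from $T \mid \Gamma \vdash_{\mathsf R} A$ and $- \mid \Delta \vdash_{\mathsf L} B$ infer $T \mid \Gamma, \Delta \vdash_{\mathsf R} A \otimes B$. $\mathrm{emb}_{\mathsf L}$ maps a focused derivation to a cut-free derivation of the same sequent (phase erased) by deleting switch steps and replacing each focused rule by the unfocused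 rule of the same name. Interpretation: $\llbracket - \rrbracket = \mathsf I$, $\llbracket A \rrbracket = A$; $\llbracket S \mid A_1,\dots,A_n \rrbracket = (\cdots(\llbracket S \rrbracket \otimes A_1)\cdots) \otimes A_n$. For $f : A \Rightarrow B$: $\llbracket f \mid () \rrbracket = f$, $\llbracket f \mid C, \Gamma \rrbracket = \llbracket f \otimes \mathrm{id}_C \mid \Gamma \rrbracket$. Define $\psi_{A,B,()} = \mathrm{id}_{A \otimes B}$, $\psi_{A,B,(C,\Gamma)} = \psi_{A,B \otimes C,\Gamma} \circ \llbracket \alpha_{A,B,C} \mid \Gamma \rrbracket$; $\varphi'_{A,(),\Delta} = \psi_{A,\mathsf I,\Delta} \circ \llbracket \rho_A \mid \Delta \rrbracket$, $\varphi'_{A,(C,\Gamma),\Delta} = \varphi'_{A \otimes C,\Gamma,\Delta}$, $\varphi_{S,\Gamma,\Delta} = \varphi'_{\llbracket S \rrbracket,\Gamma,\Delta}$. The translation $\mathrm{sound}$ from cut-free derivations of $S \mid \Gamma \vdash C$ to derivations $\llbracket S \mid \Gamma \rrbracket \Rightarrow C$: $\mathrm{sound}(\mathrm{ax}_C) = \mathrm{id}_C$; $\mathrm{sound}(\mathrm{pass}\, f) = \mathrm{sound}\, f \circ \llbracket \lambda_A \mid \Gamma' \rrbracket$ for $f : A \mid \Gamma' \vdash C$; $\mathrm{sound}(\mathsf I\mathrm L\, f) = \mathrm{sound}\, f$; $\mathrm{sound}(\otimes\mathrm L\, f) = \mathrm{sound}\, f$; $\mathrm{sound}(\mathsf I\mathrm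 R) = \mathrm{id}_{\mathsf I}$; $\mathrm{sound}(\otimes\mathrm R(f_1, f_2)) = (\mathrm{sound}\, f_1 \otimes \mathrm{sound}\, f_2) \circ \varphi_{S,\Gamma_1,\Gamma_2}$ for $f_1 : S \mid \Gamma_1 \vdash C_1$, $f_2 : - \mid \Gamma_2 \vdash C_2$. *)

(* Defs.v *)
From Stdlib Require Export List FinFun.
Export ListNotations.

Set Implicit Arguments.
Unset Strict Implicit.
Unset Printing Implicit Defensive.

Declare Scope skew_scope.
Delimit Scope skew_scope with skew.
Open Scope skew_scope.

Reserved Notation "A ⊗ B" (at level 40, left associativity).
Reserved Notation "A ⟹ B" (at level 65, no associativity).
Reserved Notation "g ∘ f" (at level 50, left associativity).
Reserved Notation "f ⊠ g" (at level 40, left associativity).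
Reserved Notation "f ≐ g" (at level 70, no associativity).

Inductive fma (Var : Type) : Type :=
| At (X : Var)
| I
| tensor (A B : fma Var).

Arguments I {Var}.
Notation "A ⊗ B" := (tensor A B) : skew_scope.

Definition ctx (Var : Type) : Type := list (fma Var).

(* [None] is the empty stoup. *)
Definition stoup (Var : Type) : Type := option (fma Var).

(* Irreducible stoups: [None] is the empty stoup, [Some X] the atom [X]. *)
Definition irr_stoup (Var : Type) : Type := option Var.

Definition stoup_of_irr (Var : Type) (T : irr_stoup Var) : stoup Var :=
  option_map (@At Var) T.

Inductive hom (Var : Type) : fma Var -> fma Var -> Type :=
| id A : A ⟹ A
| comp A B C (g : B ⟹ C) (f : A ⟹ B) : A ⟹ C
| hom_tensor A B C D (f : A ⟹ C) (g : B ⟹ D) : A ⊗ B ⟹ C ⊗ D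
| lam A : I ⊗ A ⟹ A
| rho A : A ⟹ A ⊗ I
| alpha A B C : (A ⊗ B) ⊗ C ⟹ A ⊗ (B ⊗ C)
where "A ⟹ B" := (hom A B) : skew_scope.

Arguments id {Var} A.
Arguments lam {Var} A.
Arguments rho {Var} A.
Arguments alpha {Var} A B C.
Notation "g ∘ f" := (comp g f) : skew_scope.
Notation "f ⊠ g" := (hom_tensor f g) : skew_scope.

Inductive hom_eq (Var : Type) : forall A B : fma Var, A ⟹ B -> A ⟹ B -> Prop :=
| heq_refl A B (f : A ⟹ B) : f ≐ f
| heq_sym A B (f g : A ⟹ B) : f ≐ g -> g ≐ f
| heq_trans A B (f g h : A ⟹ B) : f ≐ g -> g ≐ h -> f ≐ h
| heq_comp A B C (g g' : B ⟹ C) (f f' : A ⟹ B) :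
    g ≐ g' -> f ≐ f' -> g ∘ f ≐ g' ∘ f'
| heq_tensor A B C D (f f' : A ⟹ C) (g g' : B ⟹ D) :
    f ≐ f' -> g ≐ g' -> f ⊠ g ≐ f' ⊠ g'
| heq_idl A B (f : A ⟹ B) : id B ∘ f ≐ f
| heq_idr A B (f : A ⟹ B) : f ∘ id A ≐ f
| heq_assoc A B C D (f : A ⟹ B) (g : B ⟹ C) (h : C ⟹ D) :
    h ∘ (g ∘ f) ≐ (h ∘ g) ∘ f
| heq_tensor_id A B : id A ⊠ id B ≐ id (A ⊗ B)
| heq_tensor_comp A B C D E F (f : A ⟹ B) (h : B ⟹ C) (g : D ⟹ E) (k : E ⟹ F) :
    (h ∘ f) ⊠ (k ∘ g) ≐ (h ⊠ k) ∘ (f ⊠ g)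
| heq_lam_nat A B (f : A ⟹ B) : lam B ∘ (id I ⊠ f) ≐ f ∘ lam A
| heq_rho_nat A B (f : A ⟹ B) : (f ⊠ id I) ∘ rho A ≐ rho B ∘ f
| heq_alpha_nat A B C A' B' C' (f : A ⟹ A') (g : B ⟹ B') (h : C ⟹ C') :
    (f ⊠ (g ⊠ h)) ∘ alpha A B C ≐ alpha A' B' C' ∘ ((f ⊠ g) ⊠ h)
| heq_lam_rho : lam I ∘ rho I ≐ id I
| heq_lam_alpha_rho A B :
    (id A ⊠ lam B) ∘ alpha A I B ∘ (rho A ⊠ id B) ≐ id (A ⊗ B)
| heq_lam_alpha A B : lam (A ⊗ B) ∘ alpha I A B ≐ lam A ⊠ id B
| heq_alpha_rho A B : alpha A B I ∘ rho (A ⊗ B) ≐ id A ⊠ rho B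
| heq_pentagon A B C D :
    alpha A B (C ⊗ D) ∘ alpha (A ⊗ B) C D
    ≐ (id A ⊠ alpha B C D) ∘ alpha A (B ⊗ C) D ∘ (alpha A B C ⊠ id D)
where "f ≐ g" := (hom_eq f g) : skew_scope.

Inductive deriv (Var : Type) : stoup Var -> ctx Var -> fma Var -> Type :=
| ax A : deriv (Some A) [] A
| pass A Γ C (f : deriv (Some A) Γ C) : deriv None (A :: Γ) C
| IL Γ C (f : deriv None Γ C) : deriv (Some I) Γ C
| IR : deriv None [] I
| tensorL A B Γ C (f : deriv (Some A) (B :: Γ) C) : deriv (Some (A ⊗ B)) Γ C
| tensorR S Γ Δ A B (f : deriv S Γ A) (g : deriv None Δ B) :
    deriv S (Γ ++ Δ) (A ⊗ B).

Arguments ax {Var} A.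
Arguments IR {Var}.

Inductive focL (Var : Type) : stoup Var -> ctx Var -> fma Var -> Type :=
| passF A Γ C (f : focL (Some A) Γ C) : focL None (A :: Γ) C
| switchF T Γ C (f : focR T Γ C) : focL (stoup_of_irr T) Γ C
| ILF Γ C (f : focL None Γ C) : focL (Some I) Γ C
| tensorLF A B Γ C (f : focL (Some A) (B :: Γ) C) : focL (Some (A ⊗ B)) Γ C
with focR (Var : Type) : irr_stoup Var -> ctx Var -> fma Var -> Type :=
| axF X : focR (Some X) [] (At X)
| IRF : focR None [] I
| tensorRF T Γ Δ A B (f : focR T Γ A) (g : focL None Δ B) :
    focR T (Γ ++ Δ) (A ⊗ B).

Fixpoint embL (Var : Type) (S : stoup Var) (Γ : ctx Var) (C : fma Var)
    (h : focL S Γ C) : deriv S Γ C :=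
  match h with
  | passF f => pass (embL f)
  | switchF f => embR f
  | ILF f => IL (embL f)
  | tensorLF f => tensorL (embL f)
  end
with embR (Var : Type) (T : irr_stoup Var) (Γ : ctx Var) (C : fma Var)
    (h : focR T Γ C) : deriv (stoup_of_irr T) Γ C :=
  match h with
  | axF X => ax (At X)
  | IRF _ => IR
  | tensorRF f g => tensorR (embR f) (embL g)
  end.

Definition interp_stoup (Var : Type) (S : stoup Var) : fma Var :=
  match S with
  | None => I
  | Some A => A
  end.

Definition tensor_ctx (Var : Type) (A : fma Var) (Γ : ctx Var) : fma Var :=
  fold_left (@tensor Var) Γ A.

Definition interp (Var : Type) (S : stoup Var) (Γ : ctx Var) : fma Var :=
  tensor_ctx (interp_stoup S) Γ.

Fixpoint hom_ctx (Var : Type) (A B : fma Var) (f : A ⟹ B) (Γ : ctx Var) :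
    tensor_ctx A Γ ⟹ tensor_ctx B Γ :=
  match Γ with
  | [] => f
  | C :: Γ' => hom_ctx (f ⊠ id C) Γ'
  end.

Fixpoint psi (Var : Type) (A B : fma Var) (Γ : ctx Var) :
    tensor_ctx (A ⊗ B) Γ ⟹ A ⊗ tensor_ctx B Γ :=
  match Γ with
  | [] => id (A ⊗ B)
  | C :: Γ' => psi A (B ⊗ C) Γ' ∘ hom_ctx (alpha A B C) Γ'
  end.

Fixpoint phi' (Var : Type) (A : fma Var) (Γ Δ : ctx Var) :
    tensor_ctx A (Γ ++ Δ) ⟹ tensor_ctx A Γ ⊗ tensor_ctx I Δ :=
  match Γ with
  | [] => psi A I Δ ∘ hom_ctx (rho A) Δ
  | C :: Γ' => phi' (A ⊗ C) Γ' Δ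
  end.

Definition phi (Var : Type) (S : stoup Var) (Γ Δ : ctx Var) :
    interp S (Γ ++ Δ) ⟹ interp S Γ ⊗ interp None Δ :=
  phi' (interp_stoup S) Γ Δ.

Fixpoint sound (Var : Type) (S : stoup Var) (Γ : ctx Var) (C : fma Var)
    (f : deriv S Γ C) : interp S Γ ⟹ C :=
  match f in deriv S0 Γ0 C0 return interp S0 Γ0 ⟹ C0 with
  | ax A => id A
  | @pass _ A Γ' _ f' => sound f' ∘ hom_ctx (lam A) Γ'
  | IL f' => sound f'
  | IR => id I
  | tensorL f' => sound f'
  | @tensorR _ S' Γ1 Γ2 _ _ f1 f2 => (sound f1 ⊠ sound f2) ∘ phi S' Γ1 Γ2
  end.

(* Main.v *)
(* Existence: the homs of the form [sound (embL h)] contain the identities and are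
   closed under postcomposition with every hom, by induction on that hom; the
   left rules commute with postcomposition, and the remaining cases are coherence
   equations for [phi], so no cut elimination is needed.
   Uniqueness: the skew monoidal category of finite nonempty ordinals and
   bottom-preserving monotone maps gives an invariant of homs modulo [≐], and
   distinct focused derivations of a sequent already have distinct underlying
   maps on leaves (compare Lack and Street's coherence theorem).  The same
   invariant embeds focused derivations into a finite set. *)
Require Import Defs.
From Stdlib Require Import Setoid Morphisms Lia Arith Classical Eqdep Program.Equality.

Set Implicit Arguments.
Unset Strict Implicit.
Unset Printing Implicit Defensive.

(** * Setoid rewriting modulo [≐] *)

#[local] Instance hom_eq_equiv (Var : Type) (A B : fma Var) :
  Equivalence (@hom_eq Var A B).
Proof.
  split; [exact (@heq_refl Var A B) | exact (@heq_sym Var A B)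
         | exact (@heq_trans Var A B)].
Qed.

#[local] Instance comp_proper (Var : Type) (A B C : fma Var) :
  Proper (@hom_eq Var B C ==> @hom_eq Var A B ==> @hom_eq Var A C) (@comp Var A B C).
Proof. intros g g' Hg f f' Hf; exact (heq_comp Hg Hf). Qed.

#[local] Instance tensor_proper (Var : Type) (A B C D : fma Var) :
  Proper (@hom_eq Var A C ==> @hom_eq Var B D ==> @hom_eq Var (A ⊗ B) (C ⊗ D))
    (@hom_tensor Var A B C D).
Proof. intros f f' Hf g g' Hg; exact (heq_tensor Hf Hg). Qed.

(** * Coherence of [psi] and [phi'] *)

Lemma tensor_split_l (Var : Type) (A B C D E : fma Var)
    (g : B ⟹ C) (f : A ⟹ B) (k : D ⟹ E) :
  (g ∘ f) ⊠ k ≐ (g ⊠ k) ∘ (f ⊠ id D).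
Proof. rewrite <- heq_tensor_comp, heq_idr; reflexivity. Qed.

Lemma tensor_split_r (Var : Type) (A B C D E : fma Var)
    (g : B ⟹ C) (f : A ⟹ B) (k : D ⟹ E) :
  k ⊠ (g ∘ f) ≐ (k ⊠ g) ∘ (id D ⊠ f).
Proof. rewrite <- heq_tensor_comp, heq_idr; reflexivity. Qed.

(* [cbn] exposes the [fold_left] behind [tensor_ctx], which blocks rewriting. *)
Ltac cbn_ctx :=
  cbn;
  repeat match goal with
  | |- context [fold_left (@tensor ?V) ?G ?A] =>
      change (fold_left (@tensor V) G A) with (tensor_ctx A G)
  end.

Lemma hom_ctx_eq (Var : Type) (Γ : ctx Var) :
  forall (A B : fma Var) (f g : A ⟹ B), f ≐ g -> hom_ctx f Γ ≐ hom_ctx g Γ.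
Proof.
  induction Γ as [|C Γ IH]; intros A B f g H; cbn_ctx; [exact H|].
  apply IH; rewrite H; reflexivity.
Qed.

Lemma hom_ctx_id (Var : Type) (Γ : ctx Var) :
  forall A : fma Var, hom_ctx (id A) Γ ≐ id (tensor_ctx A Γ).
Proof.
  induction Γ as [|C Γ IH]; intros A; cbn_ctx; [reflexivity|].
  rewrite (hom_ctx_eq Γ (heq_tensor_id A C)); apply IH.
Qed.

Lemma hom_ctx_comp (Var : Type) (Γ : ctx Var) :
  forall (A B C : fma Var) (g : B ⟹ C) (f : A ⟹ B),
    hom_ctx (g ∘ f) Γ ≐ hom_ctx g Γ ∘ hom_ctx f Γ.
Proof.
  induction Γ as [|D Γ IH]; intros A B C g f; cbn_ctx; [reflexivity|].
  rewrite (hom_ctx_eq Γ (tensor_split_l g f (id D))); apply IH.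
Qed.

Lemma psi_natural_l (Var : Type) (Γ : ctx Var) :
  forall (A A' B : fma Var) (f : A ⟹ A'),
    psi A' B Γ ∘ hom_ctx (f ⊠ id B) Γ ≐ (f ⊠ id (tensor_ctx B Γ)) ∘ psi A B Γ.
Proof.
  induction Γ as [|C Γ IH]; intros A A' B f; cbn_ctx.
  - rewrite heq_idl, heq_idr; reflexivity.
  - rewrite <- heq_assoc, <- hom_ctx_comp.
    rewrite (@hom_ctx_eq _ Γ _ _ _ ((f ⊠ id (B ⊗ C)) ∘ alpha A B C)).
    + rewrite hom_ctx_comp, !heq_assoc, IH; reflexivity.
    + rewrite <- heq_alpha_nat, heq_tensor_id; reflexivity.
Qed.

Lemma psi_natural_r (Var : Type) (Γ : ctx Var) :
  forall (A B B' : fma Var) (g : B ⟹ B'),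
    psi A B' Γ ∘ hom_ctx (id A ⊠ g) Γ ≐ (id A ⊠ hom_ctx g Γ) ∘ psi A B Γ.
Proof.
  induction Γ as [|C Γ IH]; intros A B B' g; cbn_ctx.
  - rewrite heq_idl, heq_idr; reflexivity.
  - rewrite <- heq_assoc, <- hom_ctx_comp.
    rewrite (hom_ctx_eq Γ (heq_sym (heq_alpha_nat (id A) g (id C)))).
    rewrite hom_ctx_comp, !heq_assoc, IH; reflexivity.
Qed.

Lemma phi'_natural (Var : Type) (Γ Δ : ctx Var) :
  forall (A B : fma Var) (f : A ⟹ B),
    phi' B Γ Δ ∘ hom_ctx f (Γ ++ Δ)
    ≐ (hom_ctx f Γ ⊠ id (tensor_ctx I Δ)) ∘ phi' A Γ Δ.
Proof.
  induction Γ as [|C Γ IH]; intros A B f; cbn_ctx; [|apply IH].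
  rewrite <- heq_assoc, <- hom_ctx_comp.
  rewrite (hom_ctx_eq Δ (heq_sym (heq_rho_nat f))).
  rewrite hom_ctx_comp, !heq_assoc, psi_natural_l; reflexivity.
Qed.

Lemma lam_psi (Var : Type) (Γ : ctx Var) :
  forall B : fma Var, lam (tensor_ctx B Γ) ∘ psi I B Γ ≐ hom_ctx (lam B) Γ.
Proof.
  induction Γ as [|C Γ IH]; intros B; cbn_ctx; [apply heq_idr|].
  rewrite heq_assoc, (IH (B ⊗ C)), <- hom_ctx_comp.
  apply hom_ctx_eq, heq_lam_alpha.
Qed.

(** Needed for postcomposing [lam] with a [tensorR] whose first premise is [IR]. The unit that [rho]
    inserts is absorbed again by [heq_lam_rho]. *)
Lemma lam_phi (Var : Type) (Γ : ctx Var) :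
  lam (tensor_ctx I Γ) ∘ phi' I [] Γ ≐ id (tensor_ctx I Γ).
Proof.
  cbn_ctx; rewrite heq_assoc, (lam_psi Γ I), <- hom_ctx_comp.
  rewrite (hom_ctx_eq Γ (heq_lam_rho Var)); apply hom_ctx_id.
Qed.

(** An iterated pentagon: each formula of [Γ] contributes one instance of [heq_pentagon]. *)
Lemma alpha_psi (Var : Type) (Γ : ctx Var) :
  forall A B D : fma Var,
    alpha A B (tensor_ctx D Γ) ∘ psi (A ⊗ B) D Γ
    ≐ (id A ⊠ psi B D Γ) ∘ psi A (B ⊗ D) Γ ∘ hom_ctx (alpha A B D) Γ.
Proof.
  induction Γ as [|C Γ IH]; intros A B D; cbn_ctx.
  - rewrite heq_tensor_id, !heq_idl, heq_idr; reflexivity.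
  - rewrite heq_assoc, (IH A B (D ⊗ C)), tensor_split_r.
    rewrite <- !heq_assoc, <- !hom_ctx_comp.
    rewrite (hom_ctx_eq Γ (heq_pentagon A B D C)).
    rewrite !hom_ctx_comp.
    (* Reassociation puts [psi] next to the pentagon's factor [id A ⊠ alpha B D C], so that
       naturality applies. *)
    rewrite (heq_assoc _ _ (psi A (B ⊗ (D ⊗ C)) Γ)).
    rewrite (heq_assoc _ _ (psi A (B ⊗ (D ⊗ C)) Γ)).
    rewrite psi_natural_r, <- !heq_assoc; reflexivity.
Qed.

(** Carries the case of [phi'_assoc] with an empty first block. For empty [Γ] it is [alpha_psi]
    combined with [heq_alpha_rho]; the inductive step is naturality of [phi'] at [alpha]. *)
Lemma alpha_psi_phi' (Var : Type) (Γ Δ : ctx Var) :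
  forall A B : fma Var,
    alpha A (tensor_ctx B Γ) (tensor_ctx I Δ)
      ∘ (psi A B Γ ⊠ id (tensor_ctx I Δ)) ∘ phi' (A ⊗ B) Γ Δ
    ≐ (id A ⊠ phi' B Γ Δ) ∘ psi A B (Γ ++ Δ).
Proof.
  induction Γ as [|C Γ IH]; intros A B; cbn_ctx.
  - rewrite heq_tensor_id, heq_idr, heq_assoc, alpha_psi.
    rewrite tensor_split_r, <- !heq_assoc, <- hom_ctx_comp.
    rewrite (hom_ctx_eq Δ (heq_alpha_rho A B)), psi_natural_r; reflexivity.
  - rewrite tensor_split_l, heq_assoc, <- heq_assoc.
    rewrite <- phi'_natural, heq_assoc, IH, heq_assoc; reflexivity.
Qed.

(** Appending contexts is unital and associative only up to propositional equality. Making the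
    transport a hom lets it occur inside [≐] equations. *)
Definition ctx_cast (Var : Type) (A : fma Var) (Γ Δ : ctx Var) (e : Γ = Δ) :
    tensor_ctx A Γ ⟹ tensor_ctx A Δ :=
  match e with eq_refl => id _ end.

Lemma ctx_cast_refl (Var : Type) (A : fma Var) (Γ : ctx Var) (e : Γ = Γ) :
  ctx_cast A e = id (tensor_ctx A Γ).
Proof. rewrite (UIP_refl _ _ e); reflexivity. Qed.

Lemma ctx_cast_cons (Var : Type) (A C : fma Var) (Γ Δ : ctx Var)
    (e : C :: Γ = C :: Δ) (e' : Γ = Δ) :
  ctx_cast A e = ctx_cast (A ⊗ C) e'.
Proof. subst Δ; rewrite ctx_cast_refl; reflexivity. Qed.

Lemma phi'_nil_r (Var : Type) (Γ : ctx Var) :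
  forall (A : fma Var) (e : Γ = Γ ++ []),
    phi' A Γ [] ∘ ctx_cast A e ≐ rho (tensor_ctx A Γ).
Proof.
  induction Γ as [|C Γ IH]; intros A e.
  - rewrite ctx_cast_refl; cbn_ctx; rewrite heq_idl, heq_idr; reflexivity.
  - pose proof (IH (A ⊗ C) (eq_sym (app_nil_r Γ))) as H.
    rewrite <- (ctx_cast_cons A e) in H; exact H.
Qed.

(** Compares the two bracketings of a pair of nested [tensorR] steps, as postcomposition with
    [alpha] requires. The induction absorbs [Γ1] into [A] one formula at a time. *)
Lemma phi'_assoc (Var : Type) (Γ1 Γ2 Γ3 : ctx Var) :
  forall (A : fma Var) (e : (Γ1 ++ Γ2) ++ Γ3 = Γ1 ++ (Γ2 ++ Γ3)),
    alpha (tensor_ctx A Γ1) (tensor_ctx I Γ2) (tensor_ctx I Γ3)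
      ∘ (phi' A Γ1 Γ2 ⊠ id (tensor_ctx I Γ3)) ∘ phi' A (Γ1 ++ Γ2) Γ3
    ≐ (id (tensor_ctx A Γ1) ⊠ phi' I Γ2 Γ3)
        ∘ phi' A Γ1 (Γ2 ++ Γ3) ∘ ctx_cast A e.
Proof.
  induction Γ1 as [|C Γ1 IH]; intros A e.
  - rewrite ctx_cast_refl; cbn_ctx; rewrite heq_idr, tensor_split_l.
    rewrite heq_assoc, <- heq_assoc, <- phi'_natural.
    rewrite heq_assoc, alpha_psi_phi', heq_assoc; reflexivity.
  - pose proof (IH (A ⊗ C) (eq_sym (app_assoc Γ1 Γ2 Γ3))) as H.
    rewrite <- (ctx_cast_cons A e) in H; exact H.
Qed.

(** * Homs denoted by focused derivations *)

Definition focL_cast (Var : Type) (S : stoup Var) (C : fma Var) (Γ Δ : ctx Var)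
    (e : Γ = Δ) (h : focL S Δ C) : focL S Γ C :=
  eq_rect_r (fun Γ => focL S Γ C) h e.

Lemma sound_focL_cast (Var : Type) (S : stoup Var) (C : fma Var) (Γ Δ : ctx Var)
    (e : Γ = Δ) (h : focL S Δ C) :
  sound (embL (focL_cast e h)) ≐ sound (embL h) ∘ ctx_cast (interp_stoup S) e.
Proof. destruct e; cbn_ctx; rewrite heq_idr; reflexivity. Qed.

(** The right tensor rule is admissible in the left phase: it moves up through the left rules of [f]
    to the switch. Only [passF] costs an equation, naturality of [phi'] at [lam]. *)
Lemma focL_tensorR (Var : Type) (S : stoup Var) (Γ Δ : ctx Var) (A B : fma Var)
    (f : focL S Γ A) (g : focL None Δ B) :
  exists h : focL S (Γ ++ Δ) (A ⊗ B),
    (sound (embL f) ⊠ sound (embL g)) ∘ phi S Γ Δ ≐ sound (embL h).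
Proof.
  induction f as [A' Γ A f IH|T Γ A f|Γ A f IH|A' B' Γ A f IH].
  - destruct IH as [h Hh]; exists (passF h); cbn_ctx.
    change ((A' :: Γ) ++ Δ) with (A' :: (Γ ++ Δ)).
    rewrite tensor_split_l, <- Hh; unfold phi; cbn_ctx.
    rewrite <- !heq_assoc; apply heq_comp; [reflexivity|].
    symmetry; apply phi'_natural.
  - exists (switchF (tensorRF f g)); reflexivity.
  - destruct IH as [h Hh]; exists (ILF h); exact Hh.
  - destruct IH as [h Hh]; exists (tensorLF h); exact Hh.
Qed.

Lemma focL_id (Var : Type) (A : fma Var) :
  exists h : focL (Some A) [] A, id A ≐ sound (embL h).
Proof.
  induction A as [X| |A [f Hf] B [g Hg]].
  - exists (@switchF _ (Some X) _ _ (axF X)); reflexivity.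
  - exists (ILF (@switchF _ None _ _ (IRF Var))); reflexivity.
  - destruct (focL_tensorR f (passF g)) as [h Hh].
    exists (tensorLF h); cbn in *.
    rewrite <- Hh, <- Hf, <- Hg; unfold phi; cbn_ctx.
    rewrite !heq_idl, heq_assoc; symmetry; apply heq_lam_alpha_rho.
Qed.

(** All stoups and contexts are allowed because the left rules and the premises of [tensorRF] leave
    the shape of a single formula with empty context. *)
Definition focL_closed (Var : Type) (A C : fma Var) (f : A ⟹ C) : Prop :=
  forall (S : stoup Var) (Γ : ctx Var) (h : focL S Γ A),
  exists k : focL S Γ C, f ∘ sound (embL h) ≐ sound (embL k).

(* The left rules commute with postcomposition, so only right-phase derivations matter. *)
Lemma focL_closed_focR (Var : Type) (A C : fma Var) (f : A ⟹ C) :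
  (forall (T : irr_stoup Var) (Γ : ctx Var) (h : focR T Γ A),
   exists k : focL (stoup_of_irr T) Γ C, f ∘ sound (embR h) ≐ sound (embL k)) ->
  focL_closed f.
Proof.
  intros H S Γ h; revert C f H.
  induction h as [A' Γ A h IH|T Γ A h|Γ A h IH|A' B' Γ A h IH]; intros C f H.
  - destruct (IH C f H) as [k Hk]; exists (passF k); cbn_ctx.
    rewrite heq_assoc, Hk; reflexivity.
  - exact (H T Γ h).
  - destruct (IH C f H) as [k Hk]; exists (ILF k); exact Hk.
  - destruct (IH C f H) as [k Hk]; exists (tensorLF k); exact Hk.
Qed.

Lemma focL_closed_lam (Var : Type) (A : fma Var) : focL_closed (lam A).
Proof.
  apply focL_closed_focR; intros T Γ h.
  (* A right-phase derivation of [I ⊗ A] ends in [tensorRF], with [IRF] as its first premise; hence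
     the stoup and the first context are empty, and the second premise is the witness. *)
  dependent destruction h; dependent destruction h.
  exists g; cbn [embR sound]; unfold phi.
  rewrite heq_assoc, heq_lam_nat, <- heq_assoc.
  rewrite (lam_phi Δ), heq_idr; reflexivity.
Qed.

Lemma focL_closed_rho (Var : Type) (A : fma Var) : focL_closed (rho A).
Proof.
  apply focL_closed_focR; intros T Γ h.
  exists (focL_cast (eq_sym (app_nil_r Γ))
            (switchF (tensorRF h (@switchF _ None _ _ (IRF Var))))).
  rewrite sound_focL_cast; cbn [embL embR sound]; unfold phi.
  rewrite <- heq_assoc, phi'_nil_r, heq_rho_nat; reflexivity.
Qed.

Lemma focL_closed_alpha (Var : Type) (A B C : fma Var) :
  focL_closed (alpha A B C).
Proof.
  apply focL_closed_focR; intros T Γ h.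
  dependent destruction h; rename g into h3.
  dependent destruction h; rename h into h1, g into h2.
  rename Γ into Γ1, Δ0 into Γ2, Δ into Γ3.
  (* The premise [h2] may begin with left rules, so it is combined with [h3] by the admissible
     rule. *)
  destruct (focL_tensorR h2 h3) as [k Hk].
  exists (focL_cast (eq_sym (app_assoc Γ1 Γ2 Γ3)) (switchF (tensorRF h1 k))).
  rewrite sound_focL_cast; cbn [embL embR sound].
  rewrite <- Hk; unfold phi.
  rewrite tensor_split_l, tensor_split_r.
  transitivity
    ((sound (embR h1) ⊠ (sound (embL h2) ⊠ sound (embL h3)))
       ∘ (alpha _ _ _
          ∘ (phi' (interp_stoup (stoup_of_irr T)) Γ1 Γ2 ⊠ id (tensor_ctx I Γ3))
          ∘ phi' (interp_stoup (stoup_of_irr T)) (Γ1 ++ Γ2) Γ3)).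
  - rewrite !heq_assoc, heq_alpha_nat; reflexivity.
  - rewrite (phi'_assoc _ (eq_sym (app_assoc Γ1 Γ2 Γ3))), !heq_assoc; reflexivity.
Qed.

Lemma focL_closed_tensor (Var : Type) (A B C D : fma Var) (f : A ⟹ C) (g : B ⟹ D) :
  focL_closed f -> focL_closed g -> focL_closed (f ⊠ g).
Proof.
  intros Hf Hg; apply focL_closed_focR; intros T Γ h.
  dependent destruction h; rename h into h1, g0 into h2.
  destruct (Hf _ _ (switchF h1)) as [k1 H1], (Hg _ _ h2) as [k2 H2].
  destruct (focL_tensorR k1 k2) as [k Hk]; exists k.
  rewrite <- Hk, <- H1, <- H2; cbn [embL embR sound].
  rewrite heq_assoc, <- heq_tensor_comp; reflexivity.
Qed.

Lemma focL_closed_hom (Var : Type) (A C : fma Var) (f : A ⟹ C) : focL_closed f.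
Proof.
  induction f as [A|A B C g IHg f IHf|A B C D f IHf g IHg|A|A|A B C].
  - intros S Γ h; exists h; apply heq_idl.
  - intros S Γ h; destruct (IHf S Γ h) as [k Hk], (IHg S Γ k) as [l Hl].
    exists l; rewrite <- heq_assoc, Hk; exact Hl.
  - apply focL_closed_tensor; assumption.
  - apply focL_closed_lam.
  - apply focL_closed_rho.
  - apply focL_closed_alpha.
Qed.

Lemma focL_complete (Var : Type) (A C : fma Var) (f : A ⟹ C) :
  exists h : focL (Some A) [] C, f ≐ sound (embL h).
Proof.
  destruct (focL_id A) as [i Hi].
  destruct (focL_closed_hom f i) as [h Hh]; exists h.
  rewrite <- Hh, <- Hi, heq_idr; reflexivity.
Qed.

(** * Evaluation in finite ordinals *)

Fixpoint leaves (Var : Type) (A : fma Var) : nat :=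
  match A with
  | At _ | I => 1
  | A ⊗ B => leaves A + leaves B
  end.

Fixpoint ctx_leaves (Var : Type) (Γ : ctx Var) : nat :=
  match Γ with
  | [] => 0
  | A :: Γ => leaves A + ctx_leaves Γ
  end.

(* The skew monoidal functor to finite nonempty ordinals and monotone maps
   preserving the bottom element, where the tensor is the ordinal sum and every
   atom, like [I], is the one-element ordinal.  Values at arguments outside the
   source ordinal are junk. *)
Fixpoint eval (Var : Type) (A C : fma Var) (f : A ⟹ C) (n : nat) : nat :=
  match f with
  | id _ => n
  | g ∘ f => eval g (eval f n)
  | @hom_tensor _ A _ C _ f g =>
      if n <? leaves A then eval f n else leaves C + eval g (n - leaves A)
  | lam _ => pred n
  | rho _ => n
  | alpha _ _ _ => n
  end.

#[local] Arguments Nat.ltb : simpl never.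

Ltac case_ltb :=
  repeat match goal with
  | |- context [?a <? ?b] => destruct (Nat.ltb_spec a b)
  end.

Lemma leaves_pos (Var : Type) (A : fma Var) : 0 < leaves A.
Proof. induction A; cbn; lia. Qed.

Lemma eval_0 (Var : Type) (A C : fma Var) (f : A ⟹ C) : eval f 0 = 0.
Proof.
  induction f; cbn [eval pred]; auto; try congruence.
  pose proof (leaves_pos A); case_ltb; [assumption|lia].
Qed.

Lemma eval_lt (Var : Type) (A C : fma Var) (f : A ⟹ C) :
  forall n, n < leaves A -> eval f n < leaves C.
Proof.
  induction f; cbn [eval leaves]; intros n Hn; auto; try lia.
  - case_ltb; [specialize (IHf1 n)|specialize (IHf2 (n - leaves A))]; lia.
  - pose proof (leaves_pos A); lia.
Qed.

Lemma eval_hom_eq (Var : Type) (A C : fma Var) (f g : A ⟹ C) :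
  f ≐ g -> forall n, n < leaves A -> eval f n = eval g n.
Proof.
  induction 1 as [|? ? f g H IH|? ? f g h H1 IH1 H2 IH2|? ? ? g g' f f' H1 IH1 H2 IH2
    |? ? ? ? f f' g g' H1 IH1 H2 IH2| | | | |? ? ? ? ? ? f h g k|? ? f|? ? f
    |? ? ? ? ? ? f g h| | | | |]; cbn [eval leaves]; intros n Hn; try reflexivity.
  - symmetry; auto.
  - rewrite IH1; auto.
  - rewrite IH2, IH1; auto using eval_lt.
  - case_ltb; [apply IH1; assumption|rewrite IH2; lia].
  - case_ltb; lia.
  - case_ltb; try reflexivity.
    + pose proof (eval_lt f H); lia.
    + lia.
    + do 2 f_equal; lia.
  (* [lam] merges leaves 0 and 1, so naturality at leaf 0 is preservation of the bottom element. *)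
  - destruct n as [|n]; cbn.
    + rewrite eval_0; reflexivity.
    + rewrite Nat.sub_0_r; reflexivity.
  - case_ltb; [reflexivity|lia].
  - case_ltb; try lia.
    rewrite Nat.sub_add_distr; lia.
  - destruct n; [reflexivity|cbn in Hn; lia].
  - case_ltb; lia.
  - case_ltb; lia.
  - case_ltb; lia.
  - case_ltb; lia.
Qed.

Lemma ctx_leaves_cons (Var : Type) (C : fma Var) (Γ : ctx Var) :
  ctx_leaves (C :: Γ) = leaves C + ctx_leaves Γ.
Proof. reflexivity. Qed.

Lemma leaves_tensor_ctx (Var : Type) (Γ : ctx Var) :
  forall A : fma Var, leaves (tensor_ctx A Γ) = leaves A + ctx_leaves Γ.
Proof.
  induction Γ as [|C Γ IH]; intros A; cbn_ctx; [lia|].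
  rewrite IH; cbn [leaves]; lia.
Qed.

Lemma leaves_irr (Var : Type) (T : irr_stoup Var) :
  leaves (interp_stoup (stoup_of_irr T)) = 1.
Proof. destruct T; reflexivity. Qed.

Lemma ctx_leaves_app (Var : Type) (Γ Δ : ctx Var) :
  ctx_leaves (Γ ++ Δ) = ctx_leaves Γ + ctx_leaves Δ.
Proof. induction Γ as [|A Γ IH]; cbn; lia. Qed.

Lemma eval_hom_ctx (Var : Type) (Γ : ctx Var) :
  forall (A B : fma Var) (f : A ⟹ B) n,
    n < leaves A + ctx_leaves Γ ->
    eval (hom_ctx f Γ) n
    = if n <? leaves A then eval f n else leaves B + (n - leaves A).
Proof.
  induction Γ as [|C Γ IH]; intros A B f n Hn; cbn_ctx.
  - cbn in Hn; case_ltb; [reflexivity|lia].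
  - rewrite ctx_leaves_cons in Hn.
    rewrite IH; cbn [leaves eval]; [|lia]; case_ltb; lia.
Qed.

Lemma eval_psi (Var : Type) (Γ : ctx Var) :
  forall (A B : fma Var) n,
    n < leaves A + leaves B + ctx_leaves Γ -> eval (psi A B Γ) n = n.
Proof.
  induction Γ as [|C Γ IH]; intros A B n Hn; cbn_ctx; [reflexivity|].
  rewrite ctx_leaves_cons in Hn.
  rewrite eval_hom_ctx; cbn [leaves eval]; [|lia].
  case_ltb; rewrite IH; cbn [leaves]; lia.
Qed.

(** The value skipped is the leaf of the unit that [rho] inserts in front of [Δ]; [psi] only
    rebrackets. *)
Lemma eval_phi' (Var : Type) (Γ Δ : ctx Var) :
  forall (A : fma Var) n,
    n < leaves A + ctx_leaves (Γ ++ Δ) ->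
    eval (phi' A Γ Δ) n = if n <? leaves A + ctx_leaves Γ then n else S n.
Proof.
  induction Γ as [|C Γ IH]; intros A n Hn; cbn_ctx.
  - cbn [app] in Hn.
    rewrite eval_hom_ctx; cbn [leaves eval]; [|lia].
    case_ltb; rewrite eval_psi; cbn [leaves]; lia.
  - cbn [app] in Hn; rewrite ctx_leaves_cons in Hn.
    rewrite IH; cbn [leaves]; [|lia]; rewrite Nat.add_assoc; reflexivity.
Qed.

Lemma eval_passF (Var : Type) (A : fma Var) (Γ : ctx Var) (C : fma Var)
    (f : focL (Some A) Γ C) n :
  n < leaves (interp None (A :: Γ)) ->
  eval (sound (embL (passF f))) n = eval (sound (embL f)) (pred n).
Proof.
  unfold interp; rewrite leaves_tensor_ctx, ctx_leaves_cons.
  cbn [embL sound eval interp_stoup leaves]; unfold interp; intros Hn.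
  pose proof (leaves_pos A).
  rewrite eval_hom_ctx; cbn [leaves eval]; [|lia].
  case_ltb; f_equal; lia.
Qed.

(** An irreducible stoup has exactly one leaf, whence the threshold. The shift is one less than the
    threshold because leaf 0 in the source of [g] belongs to its empty stoup. *)
Lemma eval_tensorRF (Var : Type) (T : irr_stoup Var) (Γ Δ : ctx Var)
    (A B : fma Var) (f : focR T Γ A) (g : focL None Δ B) n :
  n < leaves (interp (stoup_of_irr T) (Γ ++ Δ)) ->
  eval (sound (embR (tensorRF f g))) n
  = if n <? S (ctx_leaves Γ) then eval (sound (embR f)) n
    else leaves A + eval (sound (embL g)) (n - ctx_leaves Γ).
Proof.
  unfold interp; rewrite leaves_tensor_ctx, leaves_irr.
  cbn [embR sound eval]; unfold phi, interp; intros Hn.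
  rewrite leaves_tensor_ctx, eval_phi'; rewrite leaves_irr; [|exact Hn].
  cbn [Nat.add]; destruct (Nat.ltb_spec n (S (ctx_leaves Γ))); case_ltb; try lia.
  do 2 f_equal.
Qed.

(** Axioms have a single leaf, and [tensorRF] shifts the values of its second premise by [leaves A],
    which is positive. *)
Lemma eval_focR_pos (Var : Type) (T : irr_stoup Var) (Γ : ctx Var) (C : fma Var)
    (h : focR T Γ C) :
  forall n, 0 < n < leaves (interp (stoup_of_irr T) Γ) ->
  0 < eval (sound (embR h)) n.
Proof.
  induction h as [X| |T Γ Δ A B f IH g]; intros n [H0 Hn]; try (cbn; lia).
  rewrite eval_tensorRF by exact Hn.
  pose proof (leaves_pos A); case_ltb; [apply IH|lia].
  unfold interp; rewrite leaves_tensor_ctx, leaves_irr; lia.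
Qed.

(** * Inversion of focused derivations and injectivity of their evaluation *)

Definition focR_cast (Var : Type) (T : irr_stoup Var) (C : fma Var) (Γ Δ : ctx Var)
    (e : Γ = Δ) (h : focR T Γ C) : focR T Δ C :=
  eq_rect Γ (fun Γ => focR T Γ C) h Δ e.

Lemma focL_inv (Var : Type) (S : stoup Var) (Γ : ctx Var) (C : fma Var)
    (h : focL S Γ C) :
  match S return focL S Γ C -> Prop with
  | None => fun h =>
      (exists f : focR None Γ C, h = switchF f)
      \/ (match Γ return focL None Γ C -> Prop with
          | [] => fun _ => False
          | A :: Γ => fun h => exists f : focL (Some A) Γ C, h = passF f
          end) h
  | Some (At X) => fun h =>
      exists f : focR (Some X) Γ C, h = @switchF Var (Some X) Γ C f
  | Some I => fun h => exists f : focL None Γ C, h = ILF f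
  | Some (A ⊗ B) => fun h =>
      exists f : focL (Some A) (B :: Γ) C, h = tensorLF f
  end h.
Proof.
  destruct h as [A Γ C f|[X|] Γ C f|Γ C f|A B Γ C f]; cbn; eauto.
Qed.

Lemma focR_inv (Var : Type) (T : irr_stoup Var) (Γ : ctx Var) (C : fma Var)
    (h : focR T Γ C) :
  match C return focR T Γ C -> Prop with
  | At X => fun h => exists (eT : Some X = T) (eΓ : [] = Γ),
      h = focR_cast eΓ (eq_rect _ (fun T => focR T [] (At X)) (axF X) T eT)
  | I => fun h => exists (eT : None = T) (eΓ : [] = Γ),
      h = focR_cast eΓ (eq_rect _ (fun T => focR T [] I) (IRF Var) T eT)
  | A ⊗ B => fun h =>
      exists Γ1 Γ2 (f : focR T Γ1 A) (g : focL None Γ2 B) (e : Γ1 ++ Γ2 = Γ),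
        h = focR_cast e (tensorRF f g)
  end h.
Proof.
  destruct h as [X| |T Γ Δ A B f g].
  - exists eq_refl, eq_refl; reflexivity.
  - exists eq_refl, eq_refl; reflexivity.
  - exists Γ, Δ, f, g, eq_refl; reflexivity.
Qed.

(** Every formula has a leaf, so the leaf count of a prefix determines where a context is cut. *)
Lemma app_split_leaves (Var : Type) (Γ Γ' : ctx Var) :
  forall Δ Δ', Γ ++ Δ = Γ' ++ Δ' -> ctx_leaves Γ = ctx_leaves Γ' -> Γ = Γ'.
Proof.
  revert Γ'; induction Γ as [|A Γ IH]; intros [|A' Γ'] Δ Δ' e H.
  - reflexivity.
  - rewrite ctx_leaves_cons in H; pose proof (leaves_pos A'); cbn in H; lia.
  - rewrite ctx_leaves_cons in H; pose proof (leaves_pos A); cbn in H; lia.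
  - injection e as -> e; rewrite !ctx_leaves_cons in H.
    f_equal; apply (IH _ _ _ e); lia.
Qed.

Scheme focL_focR_ind := Induction for focL Sort Prop
  with focR_focL_ind := Induction for focR Sort Prop.
Combined Scheme foc_mutind from focL_focR_ind, focR_focL_ind.

(** The map determines the last rule, and for [tensorRF] also the split of the context: the leaves
    sent below [leaves A] are exactly those of the first premise. *)
Lemma foc_eval_inj (Var : Type) :
  (forall (S : stoup Var) Γ C (h h' : focL S Γ C),
     (forall n, n < leaves (interp S Γ) ->
        eval (sound (embL h)) n = eval (sound (embL h')) n) -> h = h')
  /\
  (forall (T : irr_stoup Var) Γ C (h h' : focR T Γ C),
     (forall n, n < leaves (interp (stoup_of_irr T) Γ) ->
        eval (sound (embR h)) n = eval (sound (embR h')) n) -> h = h').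
Proof.
  (* [pass] and [switch] are told apart by whether the first leaf of the
     context is mapped to 0. *)
  assert (pass_switch : forall A (Γ : ctx Var) C (f : focL (Some A) Γ C)
            (g : focR None (A :: Γ) C),
          ~ (forall n, n < leaves (interp None (A :: Γ)) ->
               eval (sound (embL (passF f))) n = eval (sound (embR g)) n)).
  { intros A Γ C f g H.
    assert (H1 : 1 < leaves (interp None (A :: Γ))).
    { unfold interp; rewrite leaves_tensor_ctx, ctx_leaves_cons.
      pose proof (leaves_pos A); cbn; lia. }
    specialize (H 1 H1); rewrite eval_passF in H by exact H1.
    cbn [pred] in H; rewrite eval_0 in H.
    pose proof (@eval_focR_pos _ _ _ _ g 1 (conj Nat.lt_0_1 H1)); lia. }
  apply foc_mutind.
  - intros A Γ C f IH h' H.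
    destruct (focL_inv h') as [[g ->]|[f' ->]].
    + destruct (pass_switch _ _ _ _ _ H).
    + f_equal; apply IH; intros n Hn.
      assert (Hn' : S n < leaves (interp None (A :: Γ))).
      { revert Hn; unfold interp.
        rewrite !leaves_tensor_ctx, ctx_leaves_cons; cbn; lia. }
      specialize (H _ Hn'); rewrite !eval_passF in H by exact Hn'; exact H.
  - intros [X|] Γ C f IH h' H; pose proof (focL_inv h') as Hinv; cbn in Hinv.
    + destruct Hinv as [f' ->]; f_equal; apply IH; exact H.
    + destruct Hinv as [[f' ->]|Hinv]; [f_equal; apply IH; exact H|].
      destruct Γ as [|A Γ]; [destruct Hinv|]; destruct Hinv as [f' ->].
      edestruct pass_switch; intros n Hn; symmetry; apply H; exact Hn.
  - intros Γ C f IH h' H; destruct (focL_inv h') as [f' ->].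
    f_equal; apply IH; exact H.
  - intros A B Γ C f IH h' H; destruct (focL_inv h') as [f' ->].
    f_equal; apply IH; exact H.
  - intros X h' _; destruct (focR_inv h') as (eT & eΓ & ->).
    rewrite (UIP_refl _ _ eT), (UIP_refl _ _ eΓ); reflexivity.
  - intros h' _; destruct (focR_inv h') as (eT & eΓ & ->).
    rewrite (UIP_refl _ _ eT), (UIP_refl _ _ eΓ); reflexivity.
  - intros T Γ Δ A B f IHf g IHg h' H.
    destruct (focR_inv h') as (Γ' & Δ' & f' & g' & e & ->).
    assert (Hlen : leaves (interp (stoup_of_irr T) (Γ ++ Δ))
                   = S (ctx_leaves Γ + ctx_leaves Δ)).
    { unfold interp; rewrite leaves_tensor_ctx, leaves_irr, ctx_leaves_app.
      reflexivity. }
    assert (Hlen' : ctx_leaves Γ + ctx_leaves Δ = ctx_leaves Γ' + ctx_leaves Δ').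
    { rewrite <- !ctx_leaves_app, e; reflexivity. }
    assert (H' : forall n, n < S (ctx_leaves Γ + ctx_leaves Δ) ->
              (if n <? S (ctx_leaves Γ) then eval (sound (embR f)) n
               else leaves A + eval (sound (embL g)) (n - ctx_leaves Γ))
              = (if n <? S (ctx_leaves Γ') then eval (sound (embR f')) n
               else leaves A + eval (sound (embL g')) (n - ctx_leaves Γ'))).
    { intros n Hn; rewrite <- Hlen in Hn; specialize (H n Hn).
      rewrite eval_tensorRF in H by exact Hn; rewrite H.
      (* With the context generalized to a variable, [e] can be eliminated and the cast
         disappears. *)
      clear - Hn e. revert e Hn; generalize (Γ ++ Δ) as Ξ; intros Ξ <- Hn.
      exact (eval_tensorRF f' g' Hn). }
    assert (Hlt : forall Γ0 (k : focR T Γ0 A) n, n < S (ctx_leaves Γ0) ->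
               eval (sound (embR k)) n < leaves A).
    { intros Γ0 k n Hn; apply eval_lt.
      unfold interp; rewrite leaves_tensor_ctx, leaves_irr; exact Hn. }
    assert (EΓ : Γ = Γ').
    { apply (app_split_leaves (eq_sym e)).
      (* If the splits differ, the first leaf after the shorter prefix has value at least [leaves A]
         on one side and below it on the other. *)
      destruct (Nat.lt_trichotomy (ctx_leaves Γ) (ctx_leaves Γ')) as [L|[L|L]];
        [|exact L|]; exfalso.
      - specialize (H' (S (ctx_leaves Γ))); specialize (Hlt _ f' (S (ctx_leaves Γ))).
        revert H'; case_ltb; lia.
      - specialize (H' (S (ctx_leaves Γ'))); specialize (Hlt _ f (S (ctx_leaves Γ'))).
        revert H'; case_ltb; lia. }
    subst Γ'; pose proof (app_inv_head _ _ _ e) as EΔ; subst Δ'.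
    rewrite (UIP_refl _ _ e); cbn [focR_cast eq_rect]; f_equal.
    + apply IHf; intros n Hn.
      unfold interp in Hn; rewrite leaves_tensor_ctx, leaves_irr in Hn.
      specialize (H' n); revert H'; case_ltb; lia.
    (* Leaf 0 of [g] is the inserted unit, invisible in the conclusion, but its value is always 0.
       Leaf [S n] of [g] is leaf [S n + ctx_leaves Γ] of the conclusion. *)
    + apply IHg; intros [|n] Hn; [rewrite !eval_0; reflexivity|].
      unfold interp in Hn; rewrite leaves_tensor_ctx in Hn; cbn in Hn.
      specialize (H' (S n + ctx_leaves Γ)); rewrite Nat.add_sub in H'.
      revert H'; case_ltb; lia.
Qed.

Lemma focL_sound_inj (Var : Type) (A C : fma Var) (h h' : focL (Some A) [] C) :
  sound (embL h) ≐ sound (embL h') -> h = h'.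
Proof.
  intros H; apply (proj1 (foc_eval_inj Var)); intros n Hn.
  exact (eval_hom_eq H Hn).
Qed.

(** * Finiteness of the set of focused derivations *)

Lemma listing_of_injective (X Y : Type) (k : X -> Y) (l : list Y) :
  Injective k -> (forall x, In (k x) l) -> exists l' : list X, Listing l'.
Proof.
  intros Hinj Hl.
  assert (H : exists l' : list X, NoDup l' /\ forall x, In x l' <-> In (k x) l).
  { clear Hl; induction l as [|y l [l' [Hd Hin]]].
    - exists []; split; [constructor|intros x; reflexivity].
    (* Excluded middle decides whether [y] has a preimage; requiring that [y] not recur in [l] keeps
       the list free of duplicates. *)
    - destruct (classic (exists x, k x = y /\ ~ In y l)) as [[x [<- Hx]]|Hno].
      + exists (x :: l'); split.
        * constructor; [rewrite Hin; exact Hx|exact Hd].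
        * intros x'; cbn; rewrite Hin; split; intros [E|E]; auto.
          left; congruence.
      + exists l'; split; [exact Hd|]; intros x; rewrite Hin; cbn.
        split; [auto|intros [E|E]; [|exact E]].
        apply NNPP; intros Hx; apply Hno; exists x; subst y; auto. }
  destruct H as [l' [Hd Hin]]; exists l'; split; [exact Hd|].
  intros x; apply Hin, Hl.
Qed.

Lemma bounded_lists_finite (m k : nat) :
  exists L : list (list nat),
    forall l, length l = m -> (forall n, In n l -> n < k) -> In l L.
Proof.
  induction m as [|m [L HL]].
  - exists [[]]; intros [|n l] H _; [left; reflexivity|discriminate].
  - exists (flat_map (fun n => map (cons n) L) (seq 0 k)).
    intros [|n l] Hlen Hlt; [discriminate|].
    apply in_flat_map; exists n; split.
    + apply in_seq; specialize (Hlt n (or_introl eq_refl)); lia.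
    + apply in_map, HL; [injection Hlen; auto|].
      intros n' Hn'; apply Hlt; right; exact Hn'.
Qed.

Lemma focL_listing (Var : Type) (A C : fma Var) :
  exists l : list (focL (Some A) [] C), Listing l.
Proof.
  destruct (bounded_lists_finite (leaves A) (leaves C)) as [L HL].
  (* A derivation is encoded by the table of values of its map on the leaves of [A]. *)
  apply (@listing_of_injective _ _
           (fun h => map (eval (sound (embL h))) (seq 0 (leaves A))) L).
  - intros h h' H; apply (proj1 (foc_eval_inj Var)); intros n Hn.
    apply (ext_in_map H), in_seq; cbn in *; lia.
  - intros h; apply HL; [rewrite length_map, length_seq; reflexivity|].
    intros n Hn; apply in_map_iff in Hn as [i [<- Hi]].
    apply eval_lt; apply in_seq in Hi; cbn in *; lia.
Qed.

Theorem theorem5p10 (Var : Type) (A C : fma Var) :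
  (forall f : A ⟹ C,
     exists! h : focL (Some A) [] C, f ≐ sound (embL h))
  /\
  (exists focderivs : list (focL (Some A) [] C), Listing focderivs)
  /\
  (forall focderivs : list (focL (Some A) [] C),
     Listing focderivs ->
     forall f : A ⟹ C,
       exists! n : nat,
       exists g : A ⟹ C,
         nth_error (map (fun h => sound (embL h)) focderivs) n = Some g
         /\ f ≐ g).
Proof.
  split; [|split; [apply focL_listing|]].
  - intros f; destruct (focL_complete f) as [h Hh].
    exists h; split; [exact Hh|]; intros h' Hh'.
    apply focL_sound_inj; rewrite <- Hh; exact Hh'.
  - intros l [Hd Hfull] f; destruct (focL_complete f) as [h Hh].
    destruct (In_nth_error l h (Hfull h)) as [n Hn].
    exists n; split.
    + exists (sound (embL h)); split; [|exact Hh].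
      rewrite nth_error_map, Hn; reflexivity.
    + intros n' [g [Hg Hfg]]; rewrite nth_error_map in Hg.
      destruct (nth_error l n') as [h'|] eqn:Hn'; [|discriminate].
      injection Hg as <-.
      (* Two matching entries come from the same derivation, which a duplicate-free list holds at
         one position only. *)
      assert (h = h') as <-.
      { apply focL_sound_inj; rewrite <- Hh; exact Hfg. }
      apply (proj1 (NoDup_nth_error l) Hd); [|congruence].
      apply nth_error_Some; congruence.
Qed.
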